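(* Let $\Sigma$ be an alphabet of size $q\ge2$ and $\mathbf{P}$ a Parikh vector with $\ell=\sum_i\mathbf{P}_i$. The $k$-centre problem for the language $\mathcal{L}^{\Sigma}_{\mathbf{P}}$ can be solved by an approximation algorithm with approximation factor $O\!\left(\frac{(k\cdot\ell)^{2/q}}{(\log_q(k\cdot q))^2}\right)$.
   Context: A necklace of length $\ell$ over $\Sigma=\{\sigma_1<\dots<\sigma_q\}$ is an equivalence class of words of $\Sigma^\ell$ under cyclic shift. $\mathcal{L}^{\Sigma}_{\mathbf{P}}$ is the set of necklaces in which $\sigma_i$ occurs exactly $\mathbf{P}_i$ times. Same-length representatives: for necklaces $\alpha,\beta$ of lengths $m,n$ with representatives $u,v$, take $a=u^{N/m}$, $b=v^{N/n}$, $N=\mathrm{lcm}(m,n)$. For a word $a$ of length $N$ read cyclically, $M(a)$ is the multiset consisting, for each length $l\in\{1,\dots,N\}$ and each start position $i$, of the cyclic factor of length $l$ starting at $i$, labelled by its number of occurrences among start positions $\le i$. Overlap coefficient $\mathfrak{C}(\alpha,\beta)=|M(a)\cap M(b)|/\min(|M(a)|,|M(b)|)$; overlap distance $\mathfrak{O}=\infty$ if $\mathfrak{C}=0$, $0$ if $\mathfrak{C}=1$, $1/\mathfrak{C}$ otherwise. $k$-centre problem on a finite language $\mathcal{L}$: choose $S\subseteq\mathcal{L}$ with $|S|=k$ minimising $\max_{v\in\mathcal{L}}\min_{s\in S}\mathfrak{O}(s,v)$; optimum $\mathfrak{D}_{\mathcal{L},k}$; approximation factor $f$ means output value $\le f\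cdot\mathfrak{D}_{\mathcal{L},k}$.
   Formalization: The constant hidden in O(.) may depend on the alphabet size q (not on P or k), since one constant for all q is impossible (P=(1,...,1), k about q^{q/2}); the algorithm is uniform in q and runs in time polynomial in q+ℓ+k, for ℓ≥1 and 1≤k≤|L|. *)

(* Defs.v *)
From HB Require Import structures.
From mathcomp Require Import all_boot all_order all_algebra.
From mathcomp Require Import finmap multiset.
From mathcomp Require Import reals constructive_ereal exp.

Set Implicit Arguments.
Unset Strict Implicit.
Unset Printing Implicit Defensive.

Import Order.TTheory GRing.Theory Num.Theory.

Local Open Scope nat_scope.

(* The alphabet is 'I_q; the letter i stands for sigma_{i+1}. *)

Definition necklace_of q l (w : l.-tuple 'I_q) : {set l.-tuple 'I_q} :=
  [set v : l.-tuple 'I_q | [exists i : 'I_l.+1, tval v == rot i w]].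

(* Some representative of the class; the overlap coefficient below does not
   depend on which one is picked. *)
Definition representative q l (alpha : {set l.-tuple 'I_q}) : seq 'I_q :=
  if [pick w in alpha] is Some w then tval w else [::].

Definition parikh_language q (P : q.-tuple nat) :
    {set {set (sumn P).-tuple 'I_q}} :=
  [set necklace_of w | w : (sumn P).-tuple 'I_q
                         & [forall i, count_mem i w == tnth P i]].

Definition wpow (T : Type) (u : seq T) (r : nat) : seq T :=
  flatten (nseq r u).

(* The length-l factor starting at position i (counted from 0), for
   i < size a and l <= size a. *)
Definition cyclic_factor (T : Type) (a : seq T) (l i : nat) : seq T :=
  take l (rot i a).

Definition occurrence_label (T : eqType) (a : seq T) (l i : nat) : nat :=
  count (fun j => cyclic_factor a l j == cyclic_factor a l i) (iota 0 i.+1).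

Definition labelled_factors (T : choiceType) (a : seq T) :
    {mset (seq T * nat)%type}%mset :=
  seq_mset [seq (cyclic_factor a l i, occurrence_label a l i)
           | l <- iota 1 (size a), i <- iota 0 (size a)].

Section Overlap.
Variables (R : realType) (q : nat).

Definition overlap_coefficient m n
    (alpha : {set m.-tuple 'I_q}) (beta : {set n.-tuple 'I_q}) : R :=
  let N := lcmn m n in
  let A := labelled_factors (wpow (representative alpha) (N %/ m)) in
  let B := labelled_factors (wpow (representative beta) (N %/ n)) in
  ((size (A `&` B)%mset)%:R / (minn (size A) (size B))%:R)%R.

Definition overlap_distance m n
    (alpha : {set m.-tuple 'I_q}) (beta : {set n.-tuple 'I_q}) : \bar R :=
  let c := overlap_coefficient alpha beta in
  if c == 0%R then +oo%E
  else if c == 1%R then 0%E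
  else (c^-1)%:E.

Definition centre_value l (L S : {set {set l.-tuple 'I_q}}) : \bar R :=
  \big[Order.max/-oo%E]_(v in L)
    \big[Order.min/+oo%E]_(s in S) overlap_distance s v.

Definition kcentre_optimum l (L : {set {set l.-tuple 'I_q}}) (k : nat) :
    \bar R :=
  \big[Order.min/+oo%E]_(S : {set {set l.-tuple 'I_q}}
                          | (S \subset L) && (#|S| == k))
    centre_value L S.

End Overlap.

Definition logb (R : realType) (b x : R) : R := (ln x / ln b)%R.

Definition approx_rate (R : realType) (q l k : nat) : R :=
  (((k * l)%:R `^ (2 / q%:R)) / (logb q%:R (k * q)%:R) ^+ 2)%R.

(* Model of computation: Jones' WHILE language on binary trees.  All tree
   operations and control steps have unit cost, except the equality test, which
   is charged the sizes of the compared trees.  Polynomial time in this model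
   is the usual polynomial time. *)

Inductive tree : Type := Nil | Cons of tree & tree.

Fixpoint tree_size (t : tree) : nat :=
  if t is Cons t1 t2 then (tree_size t1 + tree_size t2).+1 else 1.

Fixpoint tree_eqb (t u : tree) : bool :=
  match t, u with
  | Nil, Nil => true
  | Cons t1 t2, Cons u1 u2 => tree_eqb t1 u1 && tree_eqb t2 u2
  | _, _ => false
  end.

Definition tree_hd (t : tree) : tree := if t is Cons t1 _ then t1 else Nil.
Definition tree_tl (t : tree) : tree := if t is Cons _ t2 then t2 else Nil.

(* Nil is false, every other tree is true. *)
Definition tree_true (t : tree) : bool := if t is Nil then false else true.
Definition tree_of_bool (b : bool) : tree := if b then Cons Nil Nil else Nil.

Inductive expr : Type :=
  | EVar of nat
  | ENil
  | ECons of expr & expr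
  | EHd of expr
  | ETl of expr
  | EEq of expr & expr.

Inductive cmd : Type :=
  | Skip
  | Assign of nat & expr
  | Seq of cmd & cmd
  | If of expr & cmd & cmd
  | While of expr & cmd.

Definition store := nat -> tree.

Definition update (s : store) (x : nat) (t : tree) : store :=
  fun y => if y == x then t else s y.

Fixpoint eval (s : store) (e : expr) : tree :=
  match e with
  | EVar x => s x
  | ENil => Nil
  | ECons e1 e2 => Cons (eval s e1) (eval s e2)
  | EHd e1 => tree_hd (eval s e1)
  | ETl e1 => tree_tl (eval s e1)
  | EEq e1 e2 => tree_of_bool (tree_eqb (eval s e1) (eval s e2))
  end.

Fixpoint eval_cost (s : store) (e : expr) : nat :=
  match e with
  | EVar _ | ENil => 1
  | ECons e1 e2 => (eval_cost s e1 + eval_cost s e2).+1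
  | EHd e1 | ETl e1 => (eval_cost s e1).+1
  | EEq e1 e2 =>
      (eval_cost s e1 + eval_cost s e2
       + tree_size (eval s e1) + tree_size (eval s e2)).+1
  end.

(* exec c s s' t: started in store s, c halts in store s' after time t. *)
Inductive exec : cmd -> store -> store -> nat -> Prop :=
  | ExecSkip s : exec Skip s s 1
  | ExecAssign x e s :
      exec (Assign x e) s (update s x (eval s e)) (eval_cost s e).+1
  | ExecSeq c1 c2 s s1 s2 t1 t2 :
      exec c1 s s1 t1 -> exec c2 s1 s2 t2 ->
      exec (Seq c1 c2) s s2 (t1 + t2).+1
  | ExecIfTrue e c1 c2 s s1 t :
      tree_true (eval s e) -> exec c1 s s1 t ->
      exec (If e c1 c2) s s1 (eval_cost s e + t).+1
  | ExecIfFalse e c1 c2 s s1 t :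
      ~~ tree_true (eval s e) -> exec c2 s s1 t ->
      exec (If e c1 c2) s s1 (eval_cost s e + t).+1
  | ExecWhileFalse e c s :
      ~~ tree_true (eval s e) ->
      exec (While e c) s s (eval_cost s e).+1
  | ExecWhileTrue e c s s1 s2 t1 t2 :
      tree_true (eval s e) -> exec c s s1 t1 -> exec (While e c) s1 s2 t2 ->
      exec (While e c) s s2 (eval_cost s e + t1 + t2).+1.

(* Input and output are passed in variable 0; the others start as Nil. *)
Definition runs (p : cmd) (input output : tree) (t : nat) : Prop :=
  exists2 s, exec p (update (fun _ => Nil) 0 input) s t & s 0 = output.

Definition enc_seq (s : seq tree) : tree := foldr Cons Nil s.
Definition enc_nat (n : nat) : tree := enc_seq (nseq n Nil).
Definition enc_word q (w : seq 'I_q) : tree :=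
  enc_seq [seq enc_nat (nat_of_ord i) | i <- w].

(* An instance is (k, P), with all numbers in unary (any output has k * sum P
   letters); q is the number of entries of P. *)
Definition enc_instance q (P : q.-tuple nat) (k : nat) : tree :=
  Cons (enc_nat k) (enc_seq [seq enc_nat n | n <- P]).

(* A solution is written as a list of k words, one per centre. *)
Definition enc_solution q l k (ws : k.-tuple (l.-tuple 'I_q)) : tree :=
  enc_seq [seq enc_word (tval w) | w <- ws].

Definition centres q l k (ws : k.-tuple (l.-tuple 'I_q)) :
    {set {set l.-tuple 'I_q}} :=
  [set necklace_of w | w in tval ws].

(* Main.v *)
Require Import Defs.
From mathcomp Require Import all_boot all_order all_algebra.
From mathcomp Require Import finmap multiset zify ring lra.
From mathcomp Require Import boolp reals constructive_ereal sequences exp.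
(* Again, because [seq] has an abbreviation [Nil] that hides the tree [Nil]. *)
Import Defs.

(* Every set of k distinct necklaces of the language is a good enough solution,
   so the algorithm only has to find k of them.

   Let l be the length, let x and y be the two most frequent letters, occurring
   p1 >= p2 times, and let n be about log_2 (k l).  Two necklaces share the runs
   x^j, and since only O(q p2) letters differ from x these runs alone give a
   distance O(q^3 (p2 + 1)).  Conversely, k centres have at most k l < 2^n
   factors of length n, so some word B in {x, y}^n is a factor of none of them;
   a necklace consisting of about p2 / n evenly spread copies of B shares only
   factors of length O(n l / p2) with the centres, so the optimum is
   Omega((p2 + 1) / n).  The ratio O(q^3 n) is below the rate, because a power
   of k l beats the third power of its logarithm.

   The program is a depth-first search: rotating a word and swapping its first
   two letters generate all rearrangements, so the search cannot run out of
   candidates before it has met every necklace. *)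

Set Implicit Arguments.
Unset Strict Implicit.
Unset Printing Implicit Defensive.

Import Order.TTheory GRing.Theory Num.Theory.

Local Open Scope nat_scope.

(** * The search program *)

(** Listing the registers makes updates compute to explicit lists, so most execution steps hold by
    conversion. Registers beyond the list hold the tree [Nil]. *)
Definition st (l : seq tree) : store := fun x => nth Nil l x.

Lemma update_st l x t : update (st l) x t = st (set_nth Nil l x t).
Proof. by apply/funext => y; rewrite /st nth_set_nth. Qed.

(** Time is only bounded from above, so costs of nested commands can be rounded up to simple
    formulas. *)
Definition runs_within c s s' T := exists2 t, exec c s s' t & t <= T.

Lemma rw_leq c s s' T T' : runs_within c s s' T -> T <= T' ->
  runs_within c s s' T'.
Proof. by case=> t ct tT TT'; exists t => //; apply: leq_trans TT'. Qed.

Lemma rw_seq c1 c2 s s1 s2 T1 T2 :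
  runs_within c1 s s1 T1 -> runs_within c2 s1 s2 T2 ->
  runs_within (Seq c1 c2) s s2 (T1 + T2).+1.
Proof.
case=> t1 e1 h1 [t2 e2 h2]; exists (t1 + t2).+1; first exact: ExecSeq e1 e2.
by rewrite ltnS leq_add.
Qed.

Lemma rw_assign x e l :
  runs_within (Assign x e) (st l) (st (set_nth Nil l x (eval (st l) e)))
    (eval_cost (st l) e).+1.
Proof. by rewrite -update_st; eexists; [exact: ExecAssign|]. Qed.

Lemma rw_skip s : runs_within Skip s s 1.
Proof. by eexists; [exact: ExecSkip|]. Qed.

Lemma rw_if e c1 c2 s s' T :
  runs_within (if tree_true (eval s e) then c1 else c2) s s' T ->
  runs_within (If e c1 c2) s s' (eval_cost s e + T).+1.
Proof.
case=> t et tT; exists (eval_cost s e + t).+1; last by rewrite ltnS leq_add2l.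
by case: ifPn et => h et; [apply: ExecIfTrue | apply: ExecIfFalse].
Qed.

Lemma rw_while_false x c s : ~~ tree_true (s x) ->
  runs_within (While (EVar x) c) s s 2.
Proof. by move=> h; eexists; [exact: ExecWhileFalse|]. Qed.

Lemma rw_while_true x c s s1 s2 T1 T2 : tree_true (s x) ->
  runs_within c s s1 T1 -> runs_within (While (EVar x) c) s1 s2 T2 ->
  runs_within (While (EVar x) c) s s2 (T1 + T2).+2.
Proof.
move=> h [t1 e1 h1] [t2 e2 h2]; eexists; first exact: ExecWhileTrue e1 e2.
by rewrite /= add1n addSn !ltnS leq_add.
Qed.

(** The index of the invariant is a potential that drops by one per turn, so it bounds the number of
    turns. The loop may stop earlier; at potential 0 the guard cannot be true. *)
Lemma rw_while (I : nat -> store -> Prop) x c T :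
  (forall n s, I n s -> tree_true (s x) ->
     exists n' s', [/\ n = n'.+1, I n' s' & runs_within c s s' T]) ->
  forall n s, I n s -> exists n' s',
    [/\ I n' s', ~~ tree_true (s' x)
      & runs_within (While (EVar x) c) s s' (n * T.+2 + 2)].
Proof.
move=> step; elim=> [|n IHn] s Is.
  exists 0, s; have h : ~~ tree_true (s x).
    by apply/negP => /(step _ _ Is) [? [? []]].
  by split => //; apply: rw_while_false.
case: (boolP (tree_true (s x))) => h; last first.
  exists n.+1, s; split => //.
  by apply: (rw_leq (rw_while_false _ h)); rewrite addnC leq_addr.
have [n' [s1 [[<-] I1 r1]]] := step _ _ Is h.
have [n2 [s2 [I2 h2 r2]]] := IHn _ I1.
exists n2, s2; split => //; apply: rw_leq (rw_while_true h r1 r2) _.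
lia.
Qed.

(** The list arrives reversed, so two successive pours restore its order; [rotate_cmd] uses this to
    put the first letter last. *)
Definition pour x y : cmd :=
  While (EVar x) (Seq (Assign y (ECons (EHd (EVar x)) (EVar y)))
                      (Assign x (ETl (EVar x)))).

Lemma rw_pour x y ts us l : x != y -> nth Nil l x = enc_seq ts ->
  nth Nil l y = enc_seq us ->
  runs_within (pour x y) (st l)
    (st (set_nth Nil (set_nth Nil l y (enc_seq (catrev ts us))) x Nil))
    (12 * size ts + 2).
Proof.
move=> xy; elim: ts us l => [|a ts IH] us l /= lx ly.
  have -> : st (set_nth Nil (set_nth Nil l y (enc_seq us)) x Nil) = st l.
    apply/funext => z; rewrite /st nth_set_nth /= nth_set_nth /=.
    by case: eqP => [->|_]; [rewrite lx | case: eqP => // ->].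
  by apply: rw_while_false; rewrite /st lx.
apply: rw_leq; first apply: rw_while_true.
- by rewrite /st lx.
- apply: rw_seq; first exact: rw_assign.
  exact: rw_assign.
- set l' := set_nth _ _ x _.
  have l'x : nth Nil l' x = enc_seq ts.
    rewrite /l' nth_set_nth /= eqxx /st nth_set_nth /= (negbTE xy) lx //.
  have l'y : nth Nil l' y = enc_seq (a :: us).
    rewrite /l' nth_set_nth /= eq_sym (negbTE xy) /st nth_set_nth /= eqxx.
    by rewrite lx ly.
  have -> : st (set_nth Nil (set_nth Nil l y (enc_seq (catrev ts (a :: us))))
      x Nil) = st (set_nth Nil (set_nth Nil l' y
      (enc_seq (catrev ts (a :: us)))) x Nil).
    apply/funext => z; rewrite /st /l' !nth_set_nth /= !nth_set_nth /=.
    by rewrite !nth_set_nth /= !nth_set_nth /=; do ?[case: eqP => //].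
  exact: IH.
- rewrite /=; lia.
Qed.

Definition rotate_cmd : cmd :=
  Seq (Assign 12 (ETl (EVar 10)))
  (Seq (pour 12 13)
  (Seq (Assign 10 (ECons (EHd (EVar 10)) ENil))
       (pour 13 10))).

Definition swap_cmd : cmd :=
  If (ETl (EVar 10))
    (Assign 5 (ECons (ECons (EHd (ETl (EVar 10)))
                 (ECons (EHd (EVar 10)) (ETl (ETl (EVar 10))))) (EVar 5)))
    (Assign 5 (ECons (EVar 10) (EVar 5))).

(** Register 11 is a counter: it starts as a copy of the word, so the loop makes one turn per
    rotation. *)
Definition expand_cmd : cmd :=
  While (EVar 11)
  (Seq (Assign 6 (ECons (EVar 10) (EVar 6)))
  (Seq swap_cmd
  (Seq rotate_cmd
       (Assign 11 (ETl (EVar 11)))))).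

Definition member_cmd : cmd :=
  While (EVar 8)
  (Seq (If (EEq (EVar 7) (EHd (EVar 8))) (Assign 9 (ECons ENil ENil)) Skip)
       (Assign 8 (ETl (EVar 8)))).

Definition search_body : cmd :=
  Seq (Assign 7 (EHd (EVar 5)))
  (Seq (Assign 5 (ETl (EVar 5)))
  (Seq (Assign 8 (EVar 6))
  (Seq (Assign 9 ENil)
  (Seq member_cmd
  (If (EVar 9) Skip
    (Seq (Assign 0 (ECons (EVar 7) (EVar 0)))
    (Seq (Assign 1 (ETl (EVar 1)))
    (Seq (Assign 10 (EVar 7))
    (Seq (Assign 11 (EVar 7))
         expand_cmd))))))))).

Definition fill_cmd : cmd :=
  While (EVar 4)
  (Seq (Assign 5 (ECons (EVar 3) (EVar 5)))
       (Assign 4 (ETl (EVar 4)))).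

Definition first_word_cmd : cmd :=
  While (EVar 2)
  (Seq (Assign 4 (EHd (EVar 2)))
  (Seq fill_cmd
  (Seq (Assign 3 (ECons ENil (EVar 3)))
       (Assign 2 (ETl (EVar 2)))))).

(* Registers: 0 output, 1 number of centres still to be found, 2-4 scratch for
   the first word, 5 stack of candidates, 6 all rotations of the words output
   so far, 7 current candidate, 8-13 scratch. *)
Definition search_prog : cmd :=
  Seq (Assign 1 (EHd (EVar 0)))
  (Seq (Assign 2 (ETl (EVar 0)))
  (Seq (Assign 0 ENil)
  (Seq first_word_cmd
  (Seq (Assign 5 (ECons (EVar 5) ENil))
       (While (EVar 1) search_body))))).

(** * Execution of the search commands on encoded words *)

Section Words.
Variables (T : eqType) (e : T -> tree).
Hypothesis e_inj : injective e.
Implicit Types (w u : seq T) (V C : seq (seq T)).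

Definition ew w : tree := enc_seq (map e w).
Definition ews V : tree := enc_seq (map ew V).

Definition swap2 w := if w is x :: y :: z then y :: x :: z else w.

Lemma enc_seq_inj : injective enc_seq.
Proof. by elim=> [|x s IH] [|y r] //= [-> /IH ->]. Qed.

Lemma ew_inj : injective ew.
Proof. by move=> u w /enc_seq_inj /(inj_map e_inj). Qed.

Lemma tree_eqP (t u : tree) : reflect (t = u) (tree_eqb t u).
Proof.
apply: (iffP idP) => [|<-]; last by elim: t => //= ? -> ? ->.
by elim: t u => [|a IHa b IHb] [|c d] //= /andP[/IHa -> /IHb ->].
Qed.

Lemma rw_rotate w x0 x1 x2 x3 x4 x5 x6 x7 x8 x9 x11 : 0 < size w ->
  runs_within rotate_cmd
    (st [:: x0; x1; x2; x3; x4; x5; x6; x7; x8; x9; ew w; x11; Nil; Nil])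
    (st [:: x0; x1; x2; x3; x4; x5; x6; x7; x8; x9; ew (rot 1 w); x11; Nil;
            Nil])
    (30 * size w + 30).
Proof.
case: w => // a w _.
apply: rw_leq; first apply: rw_seq; first exact: rw_assign.
- apply: rw_seq; first by apply: (@rw_pour _ _ (map e w) [::]).
  apply: rw_seq; first exact: rw_assign.
  set s' := st [:: _; _; _; _; _; _; _; _; _; _; ew (rot 1 _); _; _; _].
  have := @rw_pour 13 10 (rev (map e w)) [:: e a]
    [:: x0; x1; x2; x3; x4; x5; x6; x7; x8; x9; enc_seq [:: e a]; x11; Nil;
        enc_seq (rev (map e w))] erefl erefl erefl.
  rewrite /= !catrevE revK /s' /rot /= drop0 take0 /ew map_cat /= cats0.
  by apply.
- by rewrite /= size_rev size_map; lia.
Qed.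

Lemma rw_swap w C x0 x1 x2 x3 x4 x6 x7 x8 x9 x11 x12 x13 : 
  runs_within swap_cmd
    (st [:: x0; x1; x2; x3; x4; ews C; x6; x7; x8; x9; ew w; x11; x12; x13])
    (st [:: x0; x1; x2; x3; x4; ews (swap2 w :: C); x6; x7; x8; x9; ew w;
            x11; x12; x13])
    30.
Proof.
case: w => [|a [|b w]]; apply: rw_leq;
  try (apply: rw_if; exact: rw_assign); by [].
Qed.

(** Only the length of the counter [w'] matters; keeping it apart from [w] lets the induction go on
    while [w] is being rotated. *)
Lemma rw_expand w (w' : seq T) V C x0 x1 x2 x3 x4 x7 x8 x9 :
  0 < size w -> runs_within expand_cmd
    (st [:: x0; x1; x2; x3; x4; ews C; ews V; x7; x8; x9; ew w; ew w'; Nil;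
            Nil])
    (st [:: x0; x1; x2; x3; x4;
            ews (catrev (map swap2 (traject (rot 1) w (size w'))) C);
            ews (catrev (traject (rot 1) w (size w')) V);
            x7; x8; x9; ew (iter (size w') (rot 1) w); Nil; Nil; Nil])
    (size w' * (30 * size w + 100) + 2).
Proof.
move=> w0; elim: w' w w0 V C => [|a w' IH] w w0 V C.
  by apply: rw_leq; first exact: rw_while_false.
apply: rw_leq; first apply: rw_while_true => //.
- apply: rw_seq; first exact: rw_assign.
  apply: rw_seq; first exact: rw_swap (w) (C) _ _ _ _ _ _ _ _ _ _ _ _.
  apply: rw_seq; first exact: rw_rotate.
  exact: rw_assign.
- rewrite [X in iter X]/= iterSr.
  by apply: (IH _ _ (w :: V) (swap2 w :: C)); rewrite size_rot.
- by rewrite /= size_rot; lia.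
Qed.

(** The uniform bound [N] enters because an equality test is charged the sizes of both trees. The
    initial flag is arbitrary for the sake of the induction. *)
Lemma rw_member w V x0 x1 x2 x3 x4 x5 x6 f x10 x11 x12 x13 N :
  tree_size (ew w) <= N -> {in V, forall u, tree_size (ew u) <= N} ->
  exists2 f', tree_true f' = tree_true f || (w \in V) &
  runs_within member_cmd
    (st [:: x0; x1; x2; x3; x4; x5; x6; ew w; ews V; f; x10; x11; x12; x13])
    (st [:: x0; x1; x2; x3; x4; x5; x6; ew w; Nil; f'; x10; x11; x12; x13])
    (size V * (2 * N + 20) + 2).
Proof.
move=> wN; elim: V f => [|u V IH] f VN.
  by exists f; [rewrite orbF | exact: rw_while_false].
have uN : tree_size (ew u) <= N by apply: VN; rewrite mem_head.
have [|f' hf' rf'] := IH (if w == u then Cons Nil Nil else f).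
  by move=> v vV; apply: VN; rewrite inE vV orbT.
exists f'; first by rewrite hf' inE; case: eqP => //= _; rewrite orbT.
apply: rw_leq; first apply: rw_while_true => //.
- apply: (@rw_seq _ _ _ (st [:: x0; x1; x2; x3; x4; x5; x6; ew w;
    ews (u :: V); if w == u then Cons Nil Nil else f; x10; x11; x12; x13])
    _ (2 * N + 10)); last exact: rw_assign.
  apply: rw_leq; first apply: rw_if.
  + have -> : eval (st [:: x0; x1; x2; x3; x4; x5; x6; ew w; ews (u :: V); f;
       x10; x11; x12; x13]) (EEq (EVar 7) (EHd (EVar 8)))
       = tree_of_bool (w == u).
      congr tree_of_bool; apply/tree_eqP/eqP => /= [/ew_inj|->] //.
    (* Setting the flag costs 4 and skipping costs 1, so 4 serves both branches. *)
    instantiate (1 := 4).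
    case: (w == u) => /=; first by apply: rw_leq; first exact: rw_assign.
    by apply: (rw_leq (rw_skip _)).
  + by rewrite /=; lia.
- exact: rf'.
- by rewrite /=; lia.
Qed.

Lemma rw_search_body n w V C O x3 x7 x9 x10 N :
  0 < size w -> tree_size (ew w) <= N ->
  {in V, forall u, tree_size (ew u) <= N} ->
  exists y7 y9 y10, let: (n', O', C', V') :=
    if w \in V then (n.+1, O, C, V) else
    (n, w :: O, catrev (map swap2 (traject (rot 1) w (size w))) C,
     catrev (traject (rot 1) w (size w)) V) in
  runs_within search_body
    (st [:: ews O; enc_nat n.+1; Nil; x3; Nil; ews (w :: C); ews V; x7; Nil;
            x9; x10; Nil; Nil; Nil])
    (st [:: ews O'; enc_nat n'; Nil; x3; Nil; ews C'; ews V'; y7; Nil;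
            y9; y10; Nil; Nil; Nil])
    (size V * (2 * N + 20) + size w * (30 * size w + 100) + 100).
Proof.
move=> w0 wN VN.
have [f hf rf] := @rw_member w V (ews O) (enc_nat n.+1) Nil x3 Nil (ews C)
  (ews V) Nil x10 Nil Nil Nil N wN VN.
exists (ew w), f.
exists (if w \in V then x10 else ew (iter (size w) (rot 1) w)).
case: ifPn hf => wV /= hf; apply: rw_leq.
- do 4 (apply: rw_seq; first exact: rw_assign).
  apply: rw_seq; first exact: rf.
  by apply: rw_if => /=; rewrite /st /= hf; exact: rw_skip.
- by rewrite /=; lia.
- do 4 (apply: rw_seq; first exact: rw_assign).
  apply: rw_seq; first exact: rf.
  apply: rw_if => /=; rewrite /st /= hf.
  do 4 (apply: rw_seq; first exact: rw_assign).
  exact: rw_expand.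
- by rewrite /=; lia.
Qed.

(** * Rotations and rearrangements of a word *)

Definition rots w := traject (rot 1) w (size w).

Lemma iter_rot1 w i : i <= size w -> iter i (rot 1) w = rot i w.
Proof.
elim: i => [|i IH] ile; first by rewrite rot0.
by rewrite iterS IH ?(ltnW ile) // -rotS.
Qed.

Lemma rot_in_rots w i : 0 < size w -> rot i w \in rots w.
Proof.
move=> w0; have [ilt|ige] := ltnP i (size w).
  by apply/trajectP; exists i => //; rewrite iter_rot1 // ltnW.
by rewrite rot_oversize //; apply/trajectP; exists 0.
Qed.

Lemma rotsP w u : 0 < size w -> reflect (exists i, u = rot i w) (u \in rots w).
Proof.
move=> w0; apply: (iffP idP) => [/trajectP [i ilt ->]|[i ->]].
  by exists i; rewrite iter_rot1 // ltnW.
exact: rot_in_rots.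
Qed.

Lemma rots_rot u w i : u \in rots w -> rot i u \in rots w.
Proof.
have [/size0nil ->//|w0 /(rotsP _ w0) [j ->]] := posnP (size w).
rewrite [rot i _]rot_minn [rot j _]rot_minn size_rot.
by rewrite rot_add_mod ?geq_minr //; case: ifP => _; apply: rot_in_rots.
Qed.

Lemma rots_sym u w : u \in rots w -> w \in rots u.
Proof.
have [/size0nil ->//|w0 /(rotsP _ w0) [j ->]] := posnP (size w).
have -> : w = rotr j (rot j w) by rewrite rotK.
by rewrite /rotr rotrK; apply: rot_in_rots; rewrite size_rot.
Qed.

Lemma rots_trans u v w : u \in rots v -> v \in rots w -> u \in rots w.
Proof.
have [/size0nil ->//|v0 /(rotsP _ v0) [j ->]] := posnP (size v).
exact: rots_rot.
Qed.

Lemma rots_refl w : 0 < size w -> w \in rots w.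
Proof. by move=> w0; rewrite -{1}[w]rot0; apply: rot_in_rots. Qed.

Lemma perm_swap2 w : perm_eq (swap2 w) w.
Proof.
by case: w => [|x [|y z]] //=; apply/permP => a /=; rewrite addnCA.
Qed.

Lemma rots_perm u w : u \in rots w -> perm_eq u w.
Proof.
have [/size0nil ->//|w0 /(rotsP _ w0) [j ->]] := posnP (size w).
by rewrite perm_rot.
Qed.

(* Rotating, swapping the first two letters and rotating back exchanges two
   adjacent letters, so all rearrangements can be reached. *)
Lemma rearrangements_reachable (V : pred (seq T)) :
  (forall u i, V u -> V (rot i u)) -> (forall u, V u -> V (swap2 u)) ->
  forall w u, V w -> perm_eq u w -> V u.
Proof.
move=> Vrot Vswap.
have adj x a b y : V (x ++ a :: b :: y) -> V (x ++ b :: a :: y).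
  move=> /(Vrot _ (size x)); rewrite rot_size_cat => /Vswap /=.
  by move=> /(Vrot _ (size (b :: a :: y))); rewrite -!cat_cons rot_size_cat.
(* Repeated exchanges of neighbours carry [a] over the whole block [x]. *)
have bubble p x a y : V (p ++ x ++ a :: y) -> V (p ++ a :: x ++ y).
  elim/last_ind: x y => [|x b IH] y //.
  rewrite cat_rcons catA => /adj; rewrite -catA => /IH.
  by rewrite cat_rcons.
(* The prefix [p] is already in its final order; each turn of the induction brings the next letter
   of [t] up to it. *)
suff main t : forall p w, V (p ++ w) -> perm_eq t w -> V (p ++ t).
  by move=> w u; exact: main u [::] w.
elim: t => [|a t IH] p w Vw; first by rewrite perm_sym => /perm_nilP <-.
move=> tw; have : a \in w by rewrite -(perm_mem tw) mem_head.
move=> aw; case/splitPr: aw Vw tw => x y /bubble Vw tw.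
rewrite -cat_rcons; apply: (IH _ (x ++ y)); first by rewrite cat_rcons.
rewrite -(perm_cons a); apply: (perm_trans tw).
by rewrite perm_catC /= perm_cons perm_catC.
Qed.

(** * Invariant and correctness of the search *)

Section Search.
Variables (w0 : seq T) (k N : nat).
Hypothesis w0_gt0 : 0 < size w0.
Hypothesis w0N : forall u, perm_eq u w0 -> tree_size (ew u) <= N.
(** Expresses that at least [k] necklaces exist: fewer words cannot represent all rearrangements up
    to rotation. *)
Hypothesis kmax : forall O,
  (forall u, perm_eq u w0 -> exists2 o, o \in O & u \in rots o) -> k <= size O.

(** The potential [m] counts the pending candidates plus [size w0] for each missing centre: a known
    candidate is popped, and a new centre pays for the candidates it pushes. The rotations [V] of
    the output [O] are closed under [swap2] up to the candidates still pending in [C]. *)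
Definition search_inv m (s : store) : Prop :=
  exists n V C O, exists x3 x7 x9 x10,
  [/\ s = st [:: ews O; enc_nat n; Nil; x3; Nil; ews C; ews V; x7; Nil;
            x9; x10; Nil; Nil; Nil],
     [/\ m = size C + size w0 * n, n + size O = k & size V = size w0 * size O],
     [/\ {in C, forall u, perm_eq u w0}, {in O, forall u, perm_eq u w0},
         V =i flatten (map rots O) & pairwise (fun u v => u \notin rots v) O],
     {in V, forall u, swap2 u \in V ++ C}
   & w0 \in V ++ C].

Lemma in_flatten_rots O u :
  reflect (exists2 o, o \in O & u \in rots o) (u \in flatten (map rots O)).
Proof. exact: flatten_mapP. Qed.

Lemma search_step m s : search_inv m s -> tree_true (s 1) ->
  exists m' s', [/\ m = m'.+1, search_inv m' s' & runs_within search_body s s'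
     (k * size w0 * (2 * N + 20) + size w0 * (30 * size w0 + 100) + 100)].
Proof.
move=> [n [V [C [O [x3 [x7 [x9 [x10]]]]]]]].
case=> -> [mE nO szV] [Cw Ow VO Opw] Vsw w0VC; rewrite /st /=.
case: n mE nO => // n mE nO _.
have Vw u : u \in V -> perm_eq u w0.
  by rewrite VO => /in_flatten_rots [o /Ow ow /rots_perm /perm_trans]; apply.
case: C mE Cw Vsw w0VC => [|w C] mE Cw Vsw w0VC.
  (* With an empty stack, [V] contains [w0] and is closed under rotations and swaps, so it holds all
     rearrangements; then [kmax] contradicts that a centre is still missing. *)
  have : k <= size O; last by rewrite -nO; lia.
  apply: kmax => u uw0; apply/in_flatten_rots; rewrite -VO.
  rewrite cats0 in w0VC.
  apply: (@rearrangements_reachable (mem V)) w0VC uw0 => /= v.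
    move=> i; rewrite !VO => /in_flatten_rots [o oO vo].
    by apply/in_flatten_rots; exists o => //; apply: rots_rot.
  by move=> /Vsw; rewrite cats0.
have ww0 : perm_eq w w0 by apply: Cw; rewrite mem_head.
have szw := perm_size ww0.
have w_gt0 : 0 < size w by rewrite szw.
have [|y7 [y9 [y10]]] :=
    @rw_search_body n w V C O x3 x7 x9 x10 N w_gt0 (w0N ww0).
  by move=> u /Vw /w0N.
have szVk : size V <= k * size w0.
  by rewrite szV mulnC leq_mul2r -nO leq_addl orbT.
have tle : size V * (2 * N + 20) + size w * (30 * size w + 100) + 100 <=
  k * size w0 * (2 * N + 20) + size w0 * (30 * size w0 + 100) + 100.
  by rewrite szw !leq_add2r leq_mul2r szVk orbT.
case: ifPn => wV r.
  exists (size C + size w0 * n.+1); eexists; split; last exact: rw_leq r tle.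
    by rewrite mE.
  exists n.+1, V, C, O, x3, y7, y9, y10; split => //.
  - by split => // u uC; apply: Cw; rewrite inE uC orbT.
  - move=> u uV; have := Vsw u uV; rewrite !mem_cat inE.
    by case/or3P => [->//|/eqP ->|->]; rewrite ?wV ?orbT.
  - move: w0VC; rewrite !mem_cat inE.
    by case/or3P => [->//|/eqP ->|->]; rewrite ?wV ?orbT.
exists (size C + size w0 * n.+1); eexists; split; last exact: rw_leq r tle.
  by rewrite mE.
exists n, (catrev (rots w) V), (catrev (map swap2 (rots w)) C), (w :: O).
exists x3, y7, y9, y10; split => //.
- split; last by rewrite catrevE size_cat size_rev size_traject szw szV mulnS.
    by rewrite catrevE size_cat size_rev size_map size_traject szw mulnS; lia.
  by rewrite /= -nO addSnnS.
- split => [u|u|u|].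
  + rewrite catrevE mem_cat mem_rev => /orP [/mapP [v vw ->]|uC].
      apply: perm_trans (perm_swap2 v) _; apply: perm_trans ww0.
      exact: rots_perm.
    by apply: Cw; rewrite inE uC orbT.
  + by rewrite inE => /orP [/eqP ->//|/Ow].
  + by rewrite catrevE mem_cat mem_rev /= mem_cat VO.
  + rewrite /= Opw andbT; apply/allP => o oO; apply: contraNN wV => wo.
    by rewrite VO; apply/in_flatten_rots; exists o.
- move=> u; rewrite !catrevE !mem_cat !mem_rev => /orP [uw|/Vsw].
    by rewrite (map_f swap2 uw) /= !orbT.
  rewrite mem_cat inE => /or3P [->|/eqP ->|->]; rewrite ?orbT //.
  by rewrite rots_refl.
- move: w0VC; rewrite !catrevE !mem_cat !mem_rev inE.
  by case/or3P => [->|/eqP ->|->]; rewrite ?orbT // rots_refl.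
Qed.

Lemma search_correct x3 :
  exists O s, [/\ size O = k, {in O, forall u, perm_eq u w0},
    pairwise (fun u v => u \notin rots v) O, s 0 = ews O &
    runs_within (While (EVar 1) search_body)
    (st [:: Nil; enc_nat k; Nil; x3; Nil; ews [:: w0]; Nil; Nil; Nil;
            Nil; Nil; Nil; Nil; Nil]) s
     (((size w0 * k).+1) *
      (k * size w0 * (2 * N + 20) + size w0 * (30 * size w0 + 100) + 102) + 2)].
Proof.
(* One pending candidate and [k] missing centres give the initial potential. *)
have [|m [s [Is nt r]]] := rw_while search_step (n := (size w0 * k).+1)
  (s := (st [:: Nil; enc_nat k; Nil; x3; Nil; ews [:: w0]; Nil; Nil; Nil;
            Nil; Nil; Nil; Nil; Nil])).
  exists k, [::], [:: w0], [::], x3, Nil, Nil, Nil; split => //.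
  - by rewrite addn0 muln0.
  - by split => // u; rewrite inE => /eqP ->.
  - by rewrite mem_head.
case: Is => n [V [C [O [y3 [y7 [y9 [y10 [sE [_ nO _] [_ Ow _ Opw] _ _]]]]]]]].
exists O, s; split => //; first by move: nt nO; rewrite sE /st /=; case: n sE.
  by rewrite sE.
by apply: rw_leq r _; rewrite !addnS.
Qed.

End Search.

End Words.

(** * The initial word with the prescribed letter counts *)

Lemma rw_fill n ts x0 x1 x2 x3 s6 :
  runs_within fill_cmd
    (st [:: x0, x1, x2, x3, enc_nat n, enc_seq ts & s6])
    (st [:: x0, x1, x2, x3, Nil, enc_seq (nseq n x3 ++ ts) & s6])
    (12 * n + 2).
Proof.
elim: n ts => [|n IH] ts; first exact: rw_while_false.
apply: rw_leq; first apply: rw_while_true => //.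
- apply: rw_seq; first exact: rw_assign.
  exact: rw_assign.
- have -> : nseq n.+1 x3 ++ ts = nseq n x3 ++ x3 :: ts.
    by elim: n {IH} => //= n <-.
  exact: (IH (x3 :: ts)).
- by rewrite /=; lia.
Qed.

(** Mirrors the loop of the program, which conses the blocks one after the other, so the block of
    the last letter comes first. *)
Fixpoint first_word (i : nat) (P acc : seq nat) : seq nat :=
  if P is n :: P' then first_word i.+1 P' (nseq n i ++ acc) else acc.

Lemma rw_first_word i P acc x0 x1 s6 :
  runs_within first_word_cmd
    (st [:: x0, x1, enc_seq (map enc_nat P), enc_nat i, Nil, ew enc_nat acc
          & s6])
    (st [:: x0, x1, Nil, enc_nat (i + size P), Nil,
            ew enc_nat (first_word i P acc) & s6])
    (12 * sumn P + 30 * size P + 2).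
Proof.
elim: P i acc => [|n P IH] i acc; first by rewrite addn0; exact: rw_while_false.
apply: rw_leq; first apply: rw_while_true => //.
- apply: rw_seq; first exact: rw_assign.
  apply: rw_seq; first exact: rw_fill.
  apply: rw_seq; first exact: rw_assign.
  exact: rw_assign.
- have := IH i.+1 (nseq n i ++ acc).
  by rewrite addSnnS /ew map_cat map_nseq; apply.
- by rewrite /=; lia.
Qed.

Lemma count_first_word i P acc j :
  count_mem j (first_word i P acc) =
  (if i <= j then nth 0 P (j - i) else 0) + count_mem j acc.
Proof.
elim: P i acc => [|n P IH] i acc /=; first by rewrite nth_nil if_same.
rewrite IH count_cat count_nseq /=.
case: (ltngtP i j) => [ij|ji|->]; last by rewrite subnn /= mul1n.
  by rewrite (_ : j - i = (j - i.+1).+1) //; lia.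
by rewrite mul0n.
Qed.

Lemma ord_seq_lift q (w : seq nat) : all (fun x => x < q) w ->
  exists W : seq 'I_q, map val W = w.
Proof.
elim: w => [|x w IH] /=; first by exists [::].
by case/andP=> xq /IH [W <-]; exists (Ordinal xq :: W).
Qed.

Lemma enc_nat_inj : injective enc_nat.
Proof. by move=> m n /enc_seq_inj /(congr1 size); rewrite !size_nseq. Qed.

Lemma tree_size_enc_nat n : tree_size (enc_nat n) = n.*2.+1.
Proof. by elim: n => //= n ->; lia. Qed.

Lemma tree_size_ew q (w : seq 'I_q) :
  tree_size (ew (enc_nat \o val) w) <= (size w * (2 * q)).+1.
Proof.
elim: w => //= i w; rewrite tree_size_enc_nat => IH.
by have := ltn_ord i; rewrite mulSn /ew /= in IH *; lia.
Qed.

(** A number from [q] on has the default count 0 in [first_word], so all its entries are below [q]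
    and it lifts to the alphabet. *)
Lemma count_first_word_ord q (P : q.-tuple nat) :
  exists2 W : seq 'I_q, map val W = first_word 0 P [::] &
   forall i, count_mem i W = tnth P i.
Proof.
have [|W WE] := @ord_seq_lift q (first_word 0 P [::]).
  apply/allP => j; rewrite -has_pred1 has_count count_first_word addn0 subn0.
  apply: contraLR; rewrite -!leqNgt => qj.
  by rewrite nth_default ?size_tuple.
exists W => // i; have := count_first_word 0 P [::] i.
rewrite -WE addn0 subn0 count_map (tnth_nth 0) => <-.
by apply: eq_count => j /=; rewrite (inj_eq val_inj).
Qed.

Lemma size_parikh q (P : q.-tuple nat) (u : seq 'I_q) :
  (forall i, count_mem i u = tnth P i) -> size u = sumn P.
Proof.
move=> uP; rewrite -sum1_size (partition_big id predT) //= sumnE big_tuple.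
by apply: eq_bigr => i _; rewrite -uP sum1_count.
Qed.

(** * Correctness and running time of the whole program *)

Lemma search_time q l k : 0 < l ->
  12 * l + 30 * q + (l * k).+1 * (k * l * (2 * (l * (2 * q)).+1 + 20)
    + l * (30 * l + 100) + 102) + 40 <= 1000 * (q + l + k) ^ 6.
Proof.
move=> l0; set M := q + l + k.
have [lM qM kM] : [/\ l <= M, q <= M & k <= M] by rewrite /M; split; lia.
have M1 : 1 <= M by rewrite /M; lia.
have S1 : M <= M * M by rewrite -{1}[M]muln1 leq_mul2l M1 orbT.
have lkM := leq_mul lM kM; have lqM := leq_mul lM qM; have llM := leq_mul lM lM.
have -> : M ^ 6 = (M * M) * ((M * M) * (M * M)).
  by rewrite !mulnn -!expnM -expnD.
(* Each product of two parameters is at most [S], the square of [M], and the whole time is cubic in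
   [S]. *)
move: (M * M) S1 lkM lqM llM => S S1 lkM lqM llM.
have S1' : 1 <= S by apply: leq_trans S1.
have SS : S <= S * S by rewrite -{1}[S]muln1 leq_mul2l S1' orbT.
have hin : k * l * (2 * (l * (2 * q)).+1 + 20) + l * (30 * l + 100) + 102
    <= 258 * (S * S).
  have : (l * k) * (4 * (l * q) + 22) <= S * (26 * S) by apply: leq_mul; lia.
  by nia.
have hout : (l * k).+1 * (258 * (S * S)) <= 2 * S * (258 * (S * S)).
  by rewrite leq_mul2r; apply/orP; right; lia.
have := leq_mul (leqnn (l * k).+1) hin.
have : S <= S * (S * S).
  by rewrite -{1}[S]muln1 leq_mul2l; apply/orP; right; lia.
by rewrite -[2 * S * _]mulnA [S * (258 * _)]mulnCA in hout *; lia.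
Qed.

Lemma search_prog_correct q (P : q.-tuple nat) k : 0 < sumn P ->
  (forall O : seq (seq 'I_q),
    (forall u, (forall i, count_mem i u = tnth P i) ->
       exists2 o, o \in O & u \in rots o) -> k <= size O) ->
  exists (O : seq (seq 'I_q)) t,
  [/\ size O = k, {in O, forall u i, count_mem i u = tnth P i},
      pairwise (fun u v => u \notin rots v) O,
      runs search_prog (enc_instance P k) (enc_seq (map (@enc_word q) O)) t
    & t <= 1000 * (q + sumn P + k) ^ 6].
Proof.
move=> P0 kmax; have [W WE WP] := count_first_word_ord P.
have sumE := size_parikh (P := P).
have permP' u : perm_eq u W <-> (forall i, count_mem i u = tnth P i).
  split=> [/permP uW i|uP]; first by rewrite uW WP.
  by apply/allP => x _ /=; rewrite uP WP.
have W0 : 0 < size W by rewrite (sumE _ WP).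
have e_inj : injective (enc_nat \o @nat_of_ord q).
  by apply: inj_comp; [exact: enc_nat_inj | exact: val_inj].
set N := (sumn P * (2 * q)).+1.
have [u uW|O hO|O [s [szO Ow Opw sO r]]] :=
    @search_correct _ (enc_nat \o @nat_of_ord q) e_inj W k N W0 _ _ (enc_nat q).
- rewrite /N -(sumE _ WP) -(perm_size uW); exact: tree_size_ew.
- by apply: kmax => u /permP'; apply: hO.
have : runs_within search_prog (update (fun _ => Nil) 0 (enc_instance P k)) s
   (12 * sumn P + 30 * q + ((size W * k).+1) *
      (k * size W * (2 * N + 20) + size W * (30 * size W + 100) + 102) + 40).
  have -> : update (fun _ => Nil) 0 (enc_instance P k) =
      st [:: enc_instance P k; Nil; Nil; Nil; Nil; Nil; Nil; Nil; Nil; Nil; Nil;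
        Nil; Nil; Nil].
    apply/funext => -[|x] //=; rewrite /st /update /=.
    by do 14!case: x => [|x] //.
  apply: rw_leq.
    do 3 (apply: rw_seq; first exact: rw_assign).
    apply: rw_seq; first exact: (@rw_first_word 0 P [::]).
    apply: rw_seq; first exact: rw_assign.
    move: r; rewrite /ews /ew /= map_comp WE add0n size_tuple; exact.
  by rewrite /= size_tuple; lia.
case=> t et tle; exists O, t; split => //.
- by move=> u /Ow /permP'.
- by exists s.
apply: (leq_trans tle); rewrite (sumE _ WP) /N.
exact: search_time.
Qed.

(** * Shared factors of two words *)

Section Overlaps.
Variable T : choiceType.
Implicit Types (a b : seq T) (x : T).

Lemma size_labelled_factors a : size (labelled_factors a) = size a * size a.
Proof.
by rewrite (perm_size (perm_eq_seq_mset _)) size_allpairs !size_iota.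
Qed.

Lemma size_cyclic_factor a l i : l <= size a -> size (cyclic_factor a l i) = l.
Proof. by move=> la; rewrite size_takel // size_rot. Qed.

Lemma mem_labelled_factors a z : z \in labelled_factors a ->
  exists l i, [/\ 0 < l <= size a, i < size a & z.1 = cyclic_factor a l i].
Proof.
rewrite (perm_mem (perm_eq_seq_mset _)) => /allpairsPdep [l [i []]].
by rewrite !mem_iota => ll ii ->; exists l, i; split => //; lia.
Qed.

(** A shared factor of length at least [L] would have a shared prefix of length [L]. So the shared
    factors are shorter, and each length contributes only [size a] labelled factors of [a]. *)
Lemma overlap_le a b L : size b = size a -> 0 < L <= size a ->
  {in rots a & rots b, forall u v, take L u <> take L v} ->
  size (labelled_factors a `&` labelled_factors b)%mset <= L.-1 * size a.
Proof.
move=> ba /andP [L0 La] nab; set I := msetI _ _.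
have small : all (fun z => size z.1 < L) I.
  apply/allP => z; rewrite in_msetI => /andP [/mem_labelled_factors].
  move=> [l [i [/andP [l0 la] ia zE]]] /mem_labelled_factors.
  move=> [l' [j [/andP [l0' la'] jb zE']]]; rewrite zE size_cyclic_factor //.
  have ll' : l = l'.
    by rewrite -(size_cyclic_factor i la) -(size_cyclic_factor j la') -zE -zE'.
  rewrite ltnNge; apply/negP => Ll; apply: (nab (rot i a) (rot j b)).
  - by apply: rot_in_rots; apply: leq_ltn_trans ia.
  - by apply: rot_in_rots; apply: leq_ltn_trans jb.
  have := congr1 (take L) (etrans (esym zE) zE').
  by rewrite /cyclic_factor !take_takel // -ll'.
rewrite -(count_predT I)
  (eq_in_count (a2 := fun z => size z.1 < L)); last first.
  by move=> z zI; rewrite (allP small).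
set p := fun _ => _.
have : count p I <= count p (labelled_factors a).
  have /count_subseqP [s sub /permP ->] :
      forall z, count_mem z I <= count_mem z (labelled_factors a).
    by move=> z; rewrite !count_mem_mset msetE2 geq_minl.
  exact: leq_count_subseq.
move/leq_trans; apply; rewrite (permP (perm_eq_seq_mset _)).
have -> : iota 1 (size a) = iota 1 L.-1 ++ iota L (size a - L.-1).
  by rewrite {2}(_ : L = 1 + L.-1) -?iotaD; [congr iota; lia | lia].
rewrite map_cat flatten_cat count_cat -[X in _ <= X]addn0; apply: leq_add.
  apply: leq_trans (count_size _ _) _.
  by rewrite size_allpairs !size_iota.
rewrite leqNgt -has_count; apply/hasPn => z /allpairsPdep [l [i []]].
rewrite !mem_iota => ll ii ->; rewrite /p /= size_cyclic_factor -?leqNgt; lia.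
Qed.

(** * Runs of one letter as shared factors *)

Definition run_starts a x l :=
  count (fun i => cyclic_factor a l i == nseq l x) (iota 0 (size a)).

(** Prefix counts grow by steps of at most one, so they take every value up to the total; hence the
    labels of a factor exhaust the numbers from 1 to its number of occurrences. *)
Lemma count_prefix_surj (p : pred nat) n j : 0 < j <= count p (iota 0 n) ->
  exists i, [/\ i < n, p i & count p (iota 0 i.+1) = j].
Proof.
have countS m : count p (iota 0 m.+1) = count p (iota 0 m) + p m.
  by rewrite -addn1 iotaD count_cat /= addn0.
elim: n => [|n IH]; first by case: j.
rewrite countS => /andP [j0 jle].
have [jn|jn] := leqP j (count p (iota 0 n)).
  have [|i [ilt pi <-]] := IH; first by rewrite j0.
  by exists i; split => //; rewrite ltnW.
exists n; have pn : p n by move: jn jle; case: (p n) => //; lia.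
by split => //; move: jn jle; rewrite countS pn; lia.
Qed.

Lemma run_in_labelled_factors a x l j : 0 < l <= size a ->
  0 < j <= run_starts a x l -> (nseq l x, j) \in labelled_factors a.
Proof.
move=> la /count_prefix_surj [i [ia /eqP fi <-]].
rewrite (perm_mem (perm_eq_seq_mset _)); apply/allpairsPdep; exists l, i.
by rewrite !mem_iota /occurrence_label fi; split => //; lia.
Qed.

(** The pairs of a run of length up to [L] and a label up to [N] are distinct and lie in both
    multisets. *)
Lemma overlap_ge a b x L N : size b = size a -> L <= size a ->
  (forall l, 0 < l <= L -> N <= run_starts a x l /\ N <= run_starts b x l) ->
  L * N <= size (labelled_factors a `&` labelled_factors b)%mset.
Proof.
move=> ba La runs.
pose s := [seq (nseq l x, j) | l <- iota 1 L, j <- iota 1 N].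
have <- : size s = L * N by rewrite size_allpairs !size_iota.
apply: uniq_leq_size => [|z /allpairsPdep [l [j []]]].
  apply: allpairs_uniq; rewrite ?iota_uniq // => -[l j] [l' j'] _ _ /=.
  by case=> /(congr1 size); rewrite !size_nseq => -> ->.
rewrite !mem_iota => ll jj ->; have [|h1 h2] := runs l; first lia.
by rewrite in_msetI !run_in_labelled_factors //; lia.
Qed.

(** Both letters sit at cyclic position [i + j] of [a]. *)
Lemma nth_rotC x0 a i j : i < size a -> j < size a ->
  nth x0 (rot i a) j = nth x0 (rot j a) i.
Proof.
move=> ia ja; rewrite /rot !nth_cat !size_drop !nth_drop.
case: ltnP => h1; case: ltnP => h2; try lia; first by rewrite addnC.
by rewrite !nth_take; [congr nth|..]; lia.
Qed.

(* Each letter other than x spoils at most l of the starts of a run x^l. *)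
Lemma run_starts_ge a x l : l <= size a ->
  size a <= run_starts a x l + l * count (predC1 x) a.
Proof.
elim: l => [|l IH] la.
  rewrite /run_starts (eq_count (a2 := predT)).
    by rewrite count_predT size_iota leq_addr.
  by move=> i; rewrite /cyclic_factor take0.
apply: leq_trans (IH (ltnW la)) _; rewrite mulSnr addnA addnAC leq_add2r.
(* Windows whose last letter differs from [x] correspond to the positions of such letters in a
   rotation of [a]. *)
have <- : count (fun i => nth x (rot i a) l != x) (iota 0 (size a)) =
    count (predC1 x) a.
  rewrite (eq_in_count (a2 := fun i => predC1 x (nth x (rot l a) i))).
    rewrite -count_map -[in RHS](permP (permEl (perm_rot l a))).
    by rewrite -(size_rot l a) map_nth_iota0 // take_size.
  by move=> i; rewrite mem_iota => /andP [_ ia]; rewrite nth_rotC.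
rewrite /run_starts -count_predUI; apply: leq_trans (leq_addr _ _).
apply: sub_count => i /=; rewrite /cyclic_factor => /eqP tE.
rewrite (take_nth x) ?size_rot // tE.
have [->|] := eqVneq (nth x (rot i a) l) x; rewrite ?orbT //.
by rewrite -cats1 -(nseqD l 1) addn1 eqxx.
Qed.

(** * Words with evenly spread copies of a block *)

Fixpoint interleave (B : seq T) G t (w : seq T) :=
  if t is t'.+1 then (B ++ take G w) ++ interleave B G t' (drop G w) else [::].

(** The bound on [size w] ensures that the [t] pieces use up the whole filler. *)
Lemma count_interleave p B G t w : size w <= t * G ->
  count p (interleave B G t w) = t * count p B + count p w.
Proof.
elim: t w => [|t IH] w /=; first by rewrite leqn0 size_eq0 => /eqP ->.
move=> sw; rewrite !count_cat IH; last by rewrite size_drop; lia.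
by rewrite -[in RHS](cat_take_drop G w) count_cat mulSn; lia.
Qed.

(** A copy of [B] with its piece of filler has length at most [size B + G], so after any cut the
    next copy starts within this distance, unless the cut falls into the last block or after it. *)
Lemma interleave_suffix B G t w (x y : seq T) : x ++ y = interleave B G t w ->
  (exists z1 z2, y = z1 ++ B ++ z2 /\ size z1 <= size B + G) \/
  size y <= size B + G.
Proof.
elim: t w x => [|t IH] w x /=.
  by move/(congr1 size); rewrite size_cat /=; right; lia.
set blk := B ++ take G w; set rest := interleave _ _ _ _ => E.
have sblk : size blk <= size B + G.
  by rewrite size_cat leq_add2l size_take; case: ltnP.
have [xb|xb] := leqP (size blk) (size x).
  apply: (IH (drop G w) (drop (size blk) x)).
  have := congr1 (drop (size blk)) E.
  rewrite [in RHS]drop_size_cat // -/rest => <-.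
  rewrite drop_cat; case: ltnP => // bx.
  by rewrite drop_oversize // (_ : _ - _ = 0) ?drop0 //; lia.
have -> : y = drop (size x) blk ++ rest.
  by have := congr1 (drop (size x)) E; rewrite drop_size_cat // drop_cat xb.
have dle : size (drop (size x) blk) <= size B + G by rewrite size_drop; lia.
rewrite /rest; case: (t) => [|t'] /=; first by right; rewrite cats0.
by left; exists (drop (size x) blk); eexists; split => //; rewrite -catA.
Qed.

(** Near the end of the word the next copy of [B] is found cyclically at the beginning; the length
    bound leaves room for that copy before position [i]. *)
Lemma interleave_window B G t w i : 0 < t ->
  2 * size B + G <= size (interleave B G t w) ->
  exists2 j, j <= size B + G &
    take (size B) (drop j (rot i (interleave B G t w))) = B.
Proof.
set v := interleave _ _ _ _ => t0 vle.
have [|[z1 [z2 [E le1]]]|yle] :=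
    @interleave_suffix B G t w (take i v) (drop i v).
- exact: cat_take_drop.
- exists (size z1) => //.
  by rewrite /rot E -!catA drop_size_cat // take_size_cat.
exists (size (drop i v)) => //; rewrite /rot drop_size_cat // take_takel.
  by rewrite /v; case: t t0 {v vle yle} => //= t _; rewrite -catA take_size_cat.
by move: yle vle; rewrite size_drop; lia.
Qed.

(** A window of length [2 * size B + G] contains a full copy of [B], since one starts at offset at
    most [size B + G]. Were the window shared, a rotation of [b] would start with [B]. *)
Lemma interleave_separated B G t w b : 0 < t ->
  let a := interleave B G t w in
  size b = size a -> 2 * size B + G <= size a ->
  {in rots b, forall u, take (size B) u <> B} ->
  {in rots a & rots b, forall u v,
     take (2 * size B + G) u <> take (2 * size B + G) v}.
Proof.
move=> t0 a ba Lle avoid u v /trajectP [i ia ->] vb.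
rewrite iter_rot1 ?(ltnW ia) // => E.
have [d dle dB] := interleave_window i t0 Lle.
have /(congr1 (take (size B) \o drop d)) := E.
rewrite /= !take_drop !take_takel; try lia.
rewrite -!take_drop dB => BE.
have db : size B <= size v - d by rewrite (perm_size (rots_perm vb)) ba; lia.
apply: (avoid (rot d v)); first exact: rots_rot.
rewrite [in RHS]BE [rot d _]/rot take_cat size_drop.
case: ltnP => // h; have -> : size B = size v - d.
  by apply/eqP; rewrite eqn_leq db h.
by rewrite subnn take0 cats0 take_oversize // size_drop.
Qed.

End Overlaps.

(** * Necklaces and their distances *)

Section Necklaces.
Variables (q l : nat).
Hypothesis l_gt0 : 0 < l.
Implicit Types w v : l.-tuple 'I_q.

Lemma in_necklace_of w v : (v \in necklace_of w) = (tval v \in rots w).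
Proof.
rewrite inE; apply/existsP/(rotsP _ _) => [||[i ->]]; rewrite ?size_tuple //.
  by case=> i /eqP ->; exists i.
have [il|il] := ltnP i l; first by exists (Ordinal (ltnW il : i < l.+1)).
by exists ord0; rewrite rot0 rot_oversize ?size_tuple.
Qed.

Lemma necklace_of_eq w v :
  (necklace_of v == necklace_of w) = (tval v \in rots w).
Proof.
apply/eqP/idP => [E|vw].
  by rewrite -in_necklace_of -E in_necklace_of rots_refl ?size_tuple.
apply/setP => u; rewrite !in_necklace_of; apply/idP/idP => [uv|uw].
  exact: rots_trans vw.
by apply: (rots_trans uw); apply: rots_sym.
Qed.

End Necklaces.

Lemma parikh_representative q (P : q.-tuple nat) alpha : 0 < sumn P ->
  alpha \in parikh_language P ->
  exists w : (sumn P).-tuple 'I_q, [/\ representative alpha = w,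
    alpha = necklace_of w & forall i, count_mem i w = tnth P i].
Proof.
move=> P0 /imsetP [w]; rewrite inE => /forallP wP ->.
rewrite /representative; case: pickP => [v|/(_ w)]; last first.
  by rewrite in_necklace_of // rots_refl ?size_tuple.
rewrite in_necklace_of // => vw; exists v; split => //.
  by apply/eqP; rewrite eq_sym necklace_of_eq.
by move=> i; rewrite (permP (rots_perm vw)); apply/eqP.
Qed.

Lemma sumn_tnth q (P : q.-tuple nat) : sumn P = \sum_i tnth P i.
Proof. by rewrite sumnE big_tuple. Qed.

Section Distances.
Variables (R : realType) (q : nat) (P : q.-tuple nat).
Local Notation l := (sumn P).
Local Notation L := (parikh_language P).
Hypothesis l_gt0 : 0 < l.
Implicit Types alpha beta : {set l.-tuple 'I_q}.

Lemma overlap_coefficientE alpha beta : alpha \in L -> beta \in L ->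
  overlap_coefficient R alpha beta =
  ((size (labelled_factors (representative alpha) `&`
          labelled_factors (representative beta))%mset)%:R / (l * l)%:R)%R.
Proof.
move=> aL bL; rewrite /overlap_coefficient /lcmn gcdnn mulnK // divnn l_gt0.
rewrite /wpow /= !cats0.
have [v [-> _ _]] := parikh_representative l_gt0 aL.
have [w [-> _ _]] := parikh_representative l_gt0 bL.
by rewrite !size_labelled_factors !size_tuple minnn.
Qed.

(** At most [n.-1 * l] of the [l * l] labelled factors are shared. *)
Lemma overlap_distance_ge alpha beta n : alpha \in L -> beta \in L ->
  0 < n <= l ->
  {in rots (representative alpha) & rots (representative beta),
    forall u v, take n u <> take n v} ->
  ((l%:R / n%:R)%:E <= overlap_distance R alpha beta)%E.
Proof.
move=> aL bL /andP [n0 nl] sep.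
have := overlap_coefficientE aL bL; rewrite /overlap_distance.
set c := overlap_coefficient _ _ _; set I := size _ => cE.
have Ile : I <= n.-1 * l.
  have [v [vE _ _]] := parikh_representative l_gt0 aL.
  have [w [wE _ _]] := parikh_representative l_gt0 bL.
  rewrite -[l](size_tuple v) -vE overlap_le //.
    by rewrite vE wE !size_tuple.
  by rewrite vE size_tuple n0.
have lR : (0 < l%:R :> R)%R by rewrite ltr0n.
have cle : (c <= n.-1%:R / l%:R)%R.
  rewrite cE natrM ler_pdivrMr ?mulr_gt0 // mulrA divfK ?gt_eqF //.
  by rewrite -natrM ler_nat.
(* Strictness excludes [c = 1], where the distance would drop to 0. *)
have c1 : (c < n%:R / l%:R)%R.
  by apply: le_lt_trans cle _; rewrite ltr_pM2r ?invr_gt0 // ltr_nat prednK.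
have nl1 : (n%:R / l%:R <= 1 :> R)%R by rewrite ler_pdivrMr // mul1r ler_nat.
case: eqVneq => [_|c0]; first exact: leey.
case: eqVneq => [c1'|_]; first by move: (lt_le_trans c1 nl1); rewrite c1' ltxx.
rewrite lee_fin -[X in (X <= _)%R]invrK lef_pV2.
- by rewrite invf_div ltW.
- by rewrite posrE invr_gt0 divr_gt0 // ltr0n.
- by rewrite posrE lt_neqAle eq_sym c0 cE divr_ge0.
Qed.

(** Separation at [n = l] suffices: a common factor of full length would make the two words
    rotations of each other. *)
Lemma overlap_distance_ge1 alpha beta : alpha \in L -> beta \in L ->
  alpha != beta -> (1%:E <= overlap_distance R alpha beta)%E.
Proof.
move=> aL bL ab; have lR : (l%:R != 0 :> R)%R by rewrite pnatr_eq0 -lt0n.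
rewrite -(divff lR); apply: overlap_distance_ge; rewrite ?l_gt0 ?leqnn //.
have [v [vE aE _]] := parikh_representative l_gt0 aL.
have [w [wE bE _]] := parikh_representative l_gt0 bL.
rewrite vE wE => x y xv yw.
have sx : size x = l by rewrite (perm_size (rots_perm xv)) size_tuple.
have sy : size y = l by rewrite (perm_size (rots_perm yw)) size_tuple.
rewrite !take_oversize ?sx ?sy // => xy.
move: ab; rewrite aE bE necklace_of_eq // => /negP; apply.
by apply: (rots_trans (rots_sym xv)); rewrite xy.
Qed.

Lemma overlap_distance_ge0 alpha beta : alpha \in L -> beta \in L ->
  (0%:E <= overlap_distance R alpha beta)%E.
Proof.
move=> aL bL; rewrite /overlap_distance overlap_coefficientE //.
case: ifP => _; first exact: leey.
case: ifP => _; first by [].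
by rewrite lee_fin invr_ge0 divr_ge0.
Qed.

Lemma overlap_distance_refl alpha : alpha \in L ->
  overlap_distance R alpha alpha = 0%:E.
Proof.
move=> aL; have [v [vE _ _]] := parikh_representative l_gt0 aL.
rewrite /overlap_distance overlap_coefficientE // msetIid size_labelled_factors.
have lR : ((l * l)%:R != 0 :> R)%R by rewrite pnatr_eq0 -lt0n muln_gt0 l_gt0.
by rewrite vE size_tuple divff // oner_eq0 eqxx.
Qed.

(** [M] bounds the number of letters other than [x]. Each run of [x] of length up to [n] has at
    least [p / 2] starts in both words, so at least [p^2 / (4 M)] labelled runs are shared, and
    [l <= q * p] turns this into the bound. *)
Lemma overlap_distance_le alpha beta x M : alpha \in L -> beta \in L ->
  l <= q * tnth P x -> l <= tnth P x + M -> 0 < M ->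
  (overlap_distance R alpha beta <= (4 * M * q ^ 2)%:R%:E)%E.
Proof.
move=> aL bL; set p := tnth P x => lqp lpM M0.
rewrite /overlap_distance overlap_coefficientE //; set I := size _.
have p0 : 0 < p by case: p lqp {lpM} => //; rewrite muln0; lia.
have key : p * p <= 4 * M * I.
  have [v [vE _ vP]] := parikh_representative l_gt0 aL.
  have [w [wE _ wP]] := parikh_representative l_gt0 bL.
  (* The largest length with [2 * M * n.-1 <= p], so that the other letters leave half of [p] as run
     starts. *)
  set n := (p %/ (2 * M)).+1.
  have pn : p <= 2 * M * n by rewrite mulnC ltnW // ltn_ceil // muln_gt0.
  have nM : (n.-1 * M) * 2 <= p.
    by rewrite /= -mulnA [M * 2]mulnC leq_trunc_div.
  have runs (u : l.-tuple 'I_q) j : count_mem x u = p -> 0 < j <= n -> j <= l ->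
      uphalf p <= run_starts u x j.
    move=> up jn jl; have := @run_starts_ge _ u x j; rewrite size_tuple.
    move=> /(_ jl); have := count_predC (pred1 x) u; rewrite size_tuple up.
    set m := count (predC _) u => pm.
    have mM : m <= M by lia.
    have : j.-1 * m <= n.-1 * M by apply: leq_mul => //; lia.
    by case: j jn {jl} => // j _ /=; rewrite mulSn; lia.
  have nl : n <= l.
    have pl : p <= l.
      by rewrite -(size_tuple v) -(vP x : _ = p) count_size.
    have : p %/ (2 * M) <= p %/ 2 by apply: leq_div2l => //; lia.
    by rewrite /n; lia.
  have : n * uphalf p <= I.
    rewrite /I vE wE.
    apply: (@overlap_ge _ _ _ x); rewrite ?size_tuple // => j jn.
    by split; apply: runs => //; lia.
  have : p <= 2 * uphalf p by lia.
  move: (uphalf p) => h ph hI.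
  have := leq_mul pn ph; rewrite mulnACA; nia.
have I0 : 0 < I by case: (I) key => //; nia.
have lR : (0 < (l * l)%:R :> R)%R by rewrite ltr0n muln_gt0 l_gt0.
have IR : (0 < I%:R :> R)%R by rewrite ltr0n.
rewrite [(_ / _ == 0)%R]gt_eqF ?divr_gt0 //.
case: eqVneq => _; first by rewrite lee_fin.
rewrite lee_fin invf_div ler_pdivrMr // -natrM ler_nat.
have : l * l <= (q * p) * (q * p) by apply: leq_mul.
nia.
Qed.

End Distances.

(** * A necklace far from all given centres *)

Lemma avoided_word (T : choiceType) (x y : T) n (ws : seq (seq T)) :
  x != y -> size ws < 2 ^ n ->
  exists B, [/\ size B = n, {subset B <= [:: x; y]} & B \notin ws].
Proof.
move=> xy ws_lt.
pose f (t : n.-tuple bool) := [seq if b then x else y | b <- t].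
have f_inj : injective f.
  move=> s t /inj_map E; apply/val_inj/E => -[] [] //= /eqP.
    by rewrite (negbTE xy).
  by rewrite eq_sym (negbTE xy).
have [B BE Bws] : exists2 B, B \in map f (enum {: n.-tuple bool}) & B \notin ws.
  apply/hasP; rewrite -[has _ _]negbK -all_predC; apply/negP => /allP sub.
  move: ws_lt; rewrite -card_bool -card_tuple cardE -(size_map f) ltnNge.
  move/negP; apply; apply: uniq_leq_size => [|B /sub]; last by rewrite /= negbK.
  by rewrite map_inj_uniq // enum_uniq.
exists B; split => //.
  by case/mapP: BE => t _ ->; rewrite size_map size_tuple.
move=> z; case/mapP: BE => t _ -> /mapP [b _ ->].
by case: b; rewrite !inE eqxx ?orbT.
Qed.

Section FarNecklace.
Variables (R : realType) (q : nat) (P : q.-tuple nat).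
Local Notation l := (sumn P).
Local Notation L := (parikh_language P).
Hypothesis l_gt0 : 0 < l.

(** [B] has only [n] letters, all of them [x] or [y], so [t] copies use at most [tnth P y] of each.
    The letters left over form the filler [w], and [G] is large enough for [t] pieces to hold it. *)
Lemma avoiding_word (x y : 'I_q) n (ws : seq (seq 'I_q)) (t := tnth P y %/ n) :
  x != y -> tnth P y <= tnth P x -> 0 < n <= tnth P y -> size ws < 2 ^ n ->
  exists B G w, [/\ size B = n, B \notin ws, G = (l %/ t).+1 &
    forall i, count_mem i (interleave B G t w) = tnth P i].
Proof.
move=> xy yx /andP [n0 nl] ws_lt.
have [B [sB Bxy Bws]] := avoided_word xy ws_lt.
have tB i : t * count_mem i B <= tnth P i.
  have [iB|/count_memPn ->] := boolP (i \in B); last by rewrite muln0.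
  have : t * count_mem i B <= tnth P y.
    apply: leq_trans (leq_trunc_div _ n).
    by rewrite leq_mul2l -sB count_size orbT.
  by move: (Bxy _ iB); rewrite !inE => /orP [] /eqP -> // /leq_trans; apply.
have [w _ wP] :=
  count_first_word_ord [tuple tnth P i - t * count_mem i B | i < q].
have wi i : count_mem i w = tnth P i - t * count_mem i B.
  by rewrite wP tnth_mktuple.
exists B, (l %/ t).+1, w; split => // i.
have t0 : 0 < t by rewrite divn_gt0.
rewrite count_interleave ?wi ?subnKC //.
rewrite (size_parikh wP) sumn_tnth mulnC; apply: (@leq_trans l).
  by rewrite sumn_tnth; apply: leq_sum => j _; rewrite tnth_mktuple leq_subr.
by rewrite ltnW // ltn_ceil.
Qed.

(** The choice of [n] gives [#|S| * l < 2 ^ n], so the factors of length [n] of the centres miss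
    some word over [x] and [y]. *)
Lemma far_necklace (S : {set {set l.-tuple 'I_q}}) (x y : 'I_q)
    (n := (trunc_log 2 (#|S| * l)).+1) :
  S \subset L -> #|S| < #|L| -> x != y -> tnth P y <= tnth P x ->
  exists2 v, v \in L & {in S, forall s,
   (((tnth P y).+1%:R / (16 * n)%:R)%:E <= overlap_distance R s v)%E}.
Proof.
move=> SL SltL xy yx; set p := tnth P y.
(* Here the bound is at most 1 and any necklace outside [S] will do; the cases where the
   construction has no room reduce to this one. *)
have near : p.+1 <= 16 * n -> exists2 v, v \in L & {in S, forall s,
     ((p.+1%:R / (16 * n)%:R)%:E <= overlap_distance R s v)%E}.
  move=> pn; have /subsetPn [v vL vS] : ~~ (L \subset S).
    by apply: contraL SltL => /subset_leq_card; rewrite -leqNgt.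
  exists v => // s sS; apply: (@le_trans _ _ 1%:E); last first.
    by apply: overlap_distance_ge1 => //; [exact: (subsetP SL) |
      apply: contraNneq vS => <-].
  by rewrite lee_fin ler_pdivrMr ?ltr0n ?muln_gt0 // mul1r ler_nat.
have [pn|np] := ltnP p n; first by apply: near; lia.
pose ws := [seq take n (rot i (representative s)) | s <- enum S, i <- iota 0 l].
have [|B [G [w [sB Bws GE vP]]]] := @avoiding_word x y n ws xy yx np.
  by rewrite size_allpairs size_iota -cardE trunc_log_ltn.
set t := p %/ n in GE vP.
have t0 : 0 < t by rewrite divn_gt0.
have tn : t * n <= p := leq_trunc_div _ _.
have pl : p <= l by rewrite /p sumn_tnth (bigD1 y) //= leq_addr.
(* As [t] is about [p / n], the separating length [2 * n + G] is of order [n * l / p]. *)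
have NL : p.+1 * (2 * n + G) <= 16 * n * l.
  have h1 : p.+1 <= 2 * n * t.
    by have := ltn_ceil p (isT : 0 < n); rewrite -/t; nia.
  have tG : t * G <= l + t by rewrite GE mulnSr leq_add2r mulnC leq_trunc_div.
  have h2 : t * (2 * n + G) <= 4 * l by rewrite mulnDr; nia.
  apply: (@leq_trans (2 * n * (t * (2 * n + G)))).
    by rewrite mulnA leq_mul2r h1 orbT.
  by apply: (@leq_trans (2 * n * (4 * l))); [rewrite leq_mul2l h2 orbT | nia].
(* If the window is longer than the word, [NL] forces [p.+1 <= 16 * n]. *)
have [Nl|Nl] := leqP (2 * n + G) l; last by apply: near; nia.
have sv : size (interleave B G t w) == l by rewrite (size_parikh vP).
pose v := Tuple sv.
have vL : necklace_of v \in L.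
  by apply/imsetP; exists v => //; rewrite inE; apply/forallP => i; rewrite vP.
exists (necklace_of v) => // s sS.
have sL : s \in L by exact: (subsetP SL).
apply: (@le_trans _ _ (l%:R / (2 * n + G)%:R)%:E).
  rewrite lee_fin ler_pdivrMr ?ltr0n ?muln_gt0 // mulrAC.
  rewrite ler_pdivlMr ?ltr0n ?addn_gt0 //.
  by rewrite -!natrM ler_nat mulnC [l * _]mulnC mulnC.
apply: overlap_distance_ge => //.
have [s' [s'E _ _]] := parikh_representative l_gt0 sL.
(* The representative of the new necklace is only some rotation of [v]. *)
have [v' [v'E v'v _]] := parikh_representative l_gt0 vL.
have vv' : tval v' \in rots v by rewrite -necklace_of_eq // v'v.
rewrite s'E v'E => a b aS bv /esym; rewrite -sB.
apply: (@interleave_separated _ B G t w s') => //.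
- by rewrite size_tuple (eqP sv).
- by rewrite (eqP sv) sB.
- move=> u /trajectP [i]; rewrite size_tuple => il ->.
  rewrite iter_rot1 ?size_tuple 1?ltnW // => uB; move/negP: Bws; apply.
  apply/allpairsPdep; exists s, i; rewrite mem_enum mem_iota; split => //.
  by rewrite s'E -sB.
- exact: rots_trans bv vv'.
Qed.

(** * Bounds on the optimum and on the value of a solution *)

Lemma kcentre_optimum_ge k (x y : 'I_q) (n := (trunc_log 2 (k * l)).+1) :
  k < #|L| -> x != y -> tnth P y <= tnth P x ->
  (((tnth P y).+1%:R / (16 * n)%:R)%:E <= kcentre_optimum R L k)%E.
Proof.
move=> kL xy yx; apply: le_bigmin => [|S /andP [SL /eqP Sk]]; first exact: leey.
have [|v vL vS] := @far_necklace S x y SL _ xy yx; first by rewrite Sk.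
rewrite /centre_value; apply: bigmax_sup vL _.
by apply: le_bigmin => [|s sS]; [exact: leey | rewrite /n -Sk; exact: vS].
Qed.

Lemma kcentre_optimum_ge0 k : 0 < #|L| ->
  (0%:E <= kcentre_optimum R L k)%E.
Proof.
case/card_gt0P => v vL.
apply: le_bigmin => [|S /andP [SL _]]; first exact: leey.
apply: bigmax_sup (vL) _; apply: le_bigmin => [|s sS]; first exact: leey.
by apply: overlap_distance_ge0 => //; exact: (subsetP SL).
Qed.

Lemma centre_value_le (S : {set {set l.-tuple 'I_q}}) B :
  S \subset L -> 0 < #|S| ->
  {in L &, forall s v, (overlap_distance R s v <= B)%E} ->
  (centre_value R L S <= B)%E.
Proof.
move=> SL /card_gt0P [s sS] dB; apply: bigmax_le => [|v vL]; first exact: leNye.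
by apply: bigmin_inf (sS) _; apply: dB => //; exact: (subsetP SL).
Qed.

(** Each necklace is its own centre. This serves the case where [k] is the size of the language and
    no far necklace exists. *)
Lemma centre_value_full : (centre_value R L L <= 0)%E.
Proof.
apply: bigmax_le => [|v vL]; first exact: leNye.
by apply: bigmin_inf (vL) _; rewrite overlap_distance_refl.
Qed.

End FarNecklace.

(** * The approximation rate *)

Section Rate.
Variable R : realType.
Local Open Scope ring_scope.

(** The bound [ln (1 + x) <= x] at [x = - 1 / 2]. *)
Lemma ln2_ge_half : 2^-1 <= ln (2 : R).
Proof.
have := @le_ln1Dx R (- 2^-1).
have -> : 1 + - 2^-1 = (2 : R)^-1 by field.
rewrite lnV ?posrE // => /(_ _) h.
have : - ln (2 : R) <= - 2^-1 by apply: h; lra.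
lra.
Qed.

(* exp z >= 1 + z at z = 2y/(3q), cubed. *)
Lemma cube_le_powR (q : nat) (x : R) : (0 < q)%N -> 1 <= x ->
  (1 + ln x) ^+ 3 <= (2 * q%:R) ^+ 3 * x `^ (2 / q%:R).
Proof.
move=> q0 x1; have x0 : 0 < x by apply: lt_le_trans x1.
have qR : (1 <= q%:R :> R) by rewrite ler1n.
set y := ln x; have y0 : 0 <= y by rewrite ln_ge0.
set z := 2 * y / (3 * q%:R).
have -> : x `^ (2 / q%:R) = expR z ^+ 3.
  rewrite -expRM_natl /powR gt_eqF // -/y; congr expR.
  by rewrite /z; field; rewrite pnatr_eq0 -lt0n.
rewrite -exprMn; apply: lerXn2r; rewrite ?nnegrE.
- by apply: addr_ge0.
- by rewrite mulr_ge0 ?expR_ge0 // mulr_ge0.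
apply: (@le_trans _ _ (2 * q%:R * (1 + z))).
  have -> : 2 * q%:R * (1 + z) = 2 * q%:R + 4 / 3 * y.
    by rewrite /z; field; rewrite pnatr_eq0 -lt0n.
  lra.
by rewrite ler_pM2l ?mulr_gt0 ?ltr0n // expR_ge1Dx.
Qed.

(** With [y = ln (k * l)], both [n.+1] and the logarithm [b] in the rate are at most [2 * (1 + y)].
    Hence [n.+1 * b ^+ 2] is at most [8 * (1 + y) ^+ 3], which [cube_le_powR] compares with the
    numerator. *)
Lemma approx_rate_ge (q l k : nat) : (1 < q)%N -> (0 < l)%N -> (0 < k)%N ->
  (trunc_log 2 (k * l)).+1%:R <= 8 * (2 * q%:R) ^+ 3 * approx_rate R q l k.
Proof.
move=> q1 l0 k0; set n := trunc_log _ _; set x := (k * l)%:R : R.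
have x1 : 1 <= x by rewrite ler1n muln_gt0 k0.
have x0 : 0 < x by apply: lt_le_trans x1.
set y := ln x; have y0 : 0 <= y by rewrite ln_ge0.
have l2 := ln2_ge_half.
have nle : n.+1%:R <= 2 * (1 + y).
  have : ln (2 ^+ n : R) <= y.
    rewrite ler_ln ?posrE ?exprn_gt0 // -natrX ler_nat trunc_logP //.
    by rewrite muln_gt0 k0.
  rewrite lnXn // -[X in X <= _]mulr_natr => h.
  have n0 : 0 <= n%:R :> R by [].
  by have := ler_wpM2r n0 l2; rewrite -[n.+1%:R]natr1; lra.
have qR : (2 <= q%:R :> R) by rewrite ler_nat.
have lnq : 2^-1 <= ln (q%:R : R).
  by apply: (le_trans l2); rewrite ler_ln ?posrE //; lra.
set b := logb (q%:R : R) (k * q)%:R.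
have bE : b = 1 + ln (k%:R : R) / ln (q%:R : R).
  rewrite /b /logb natrM lnM ?posrE ?ltr0n ?(ltnW q1) // mulrDl.
  rewrite divff 1?addrC //.
  by rewrite gt_eqF //; lra.
have k1 : 1 <= k%:R :> R by rewrite ler1n.
have lnk0 : 0 <= ln (k%:R : R) by rewrite ln_ge0.
have lnky : ln (k%:R : R) <= y.
  by rewrite /y ler_ln ?posrE // ?ltr0n // /x ler_nat leq_pmulr.
have b1 : 1 <= b.
  by rewrite bE lerDl divr_ge0 //; lra.
have b2 : b <= 2 * (1 + y).
  rewrite bE; have : ln (k%:R : R) / ln (q%:R : R) <= 2 * y.
    by rewrite ler_pdivrMr; [nra | lra].
  lra.
have c := cube_le_powR (ltnW q1) x1.
rewrite /approx_rate -/x -/b mulrA ler_pdivlMr ?exprn_gt0 //; last lra.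
apply: (@le_trans _ _ (8 * (1 + y) ^+ 3)); last first.
  by rewrite -mulrA ler_pM2l.
have -> : 8 * (1 + y) ^+ 3 = (2 * (1 + y)) * (2 * (1 + y)) ^+ 2 by ring.
apply: ler_pM => //; first by rewrite exprn_ge0 //; lra.
by apply: lerXn2r => //; rewrite ?nnegrE; lra.
Qed.

End Rate.

(** * Combining the search with the two distance bounds *)

Lemma tuple_seq_lift (T : Type) n (ws : seq (seq T)) :
  all (fun w => size w == n) ws -> exists W : seq (n.-tuple T), map val W = ws.
Proof.
elim: ws => [|w ws IH] /=; first by exists [::].
by case/andP=> wn /IH [W <-]; exists (Tuple wn :: W).
Qed.

(** Take [x] with the largest count and [y] with the largest count among the other letters. *)
Lemma two_most_frequent q : 2 <= q -> forall P : q.-tuple nat,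
  exists x y : 'I_q, [/\ x != y, tnth P y <= tnth P x, sumn P <= q * tnth P x
    & sumn P <= tnth P x + q * tnth P y].
Proof.
case: q => [|[|q]] // _ P.
have [x _ xmax] := @arg_maxnP _ ord0 predT (tnth P) isT.
have [j jx] : exists j : 'I_q.+2, j != x.
  by case: (eqVneq ord0 x) => [<-|]; [exists ord_max | exists ord0].
have [y yx ymax] := @arg_maxnP _ j [pred i | i != x] (tnth P) jx.
exists x, y; split; rewrite 1?eq_sym //; first exact: xmax.
  rewrite sumn_tnth; apply: (@leq_trans (\sum_(i < q.+2) tnth P x)).
    by apply: leq_sum => i _; exact: xmax.
  by rewrite sum_nat_const card_ord.
rewrite sumn_tnth (bigD1 x) //= leq_add2l.
apply: (@leq_trans (\sum_(i < q.+2 | i != x) tnth P y)).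
  by apply: leq_sum => i ix; exact: ymax.
by rewrite sum_nat_const leq_mul2r -[X in _ <= X]card_ord max_card orbT.
Qed.

Theorem theorem7 (R : realType) :
  exists (p : cmd) (c d : nat),
  forall q : nat, 2 <= q ->
  exists C : R, (0 < C)%R /\
  forall (P : q.-tuple nat) (k : nat),
    0 < sumn P -> 1 <= k -> k <= #|parikh_language P| ->
  exists (ws : k.-tuple ((sumn P).-tuple 'I_q)) (t : nat),
    [/\ runs p (enc_instance P k) (enc_solution ws) t,
        t <= c * (q + sumn P + k) ^ d,
        centres ws \subset parikh_language P,
        #|centres ws| = k
      & (centre_value R (parikh_language P) (centres ws)
         <= (C * approx_rate R q (sumn P) k)%:E
            * kcentre_optimum R (parikh_language P) k)%E].
Proof.
exists search_prog, 1000, 6 => q q2.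
(* [B] is the factor in [approx_rate_ge]; [A * n] is the quotient of the upper bound
   [4 * q ^ 3 * p.+1] on the output value by the lower bound [p.+1 / (16 * n)] on the optimum. *)
pose A : R := (64 * q%:R ^+ 3)%R; pose B : R := (8 * (2 * q%:R) ^+ 3)%R.
have qR : (0 < q%:R :> R)%R by rewrite ltr0n ltnW.
have A0 : (0 < A)%R by rewrite mulr_gt0 ?exprn_gt0.
have B0 : (0 < B)%R by rewrite mulr_gt0 ?exprn_gt0 ?mulr_gt0.
exists (A * B)%R; split; first exact: mulr_gt0.
move=> P k l0 k0 kL; set L := parikh_language P in kL *.
have [O cover|O [t [sO OP Opw run tle]]] := @search_prog_correct q P k l0.
  (* The necklaces of a covering list include the whole language; words of the wrong length get the
     dummy value [set0]. *)
  apply: (leq_trans kL); pose f (o : seq 'I_q) :=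
    if insub o is Some w then @necklace_of q (sumn P) w else finset.set0.
  rewrite -(size_map f O); apply: leq_trans (card_size _).
  apply: subset_leq_card; apply/subsetP => alpha aL.
  have [w [_ -> wP]] := parikh_representative l0 aL.
  have [o oO wo] := cover _ wP; apply/mapP; exists o => //.
  have so : size o == sumn P by rewrite -(perm_size (rots_perm wo)) size_tuple.
  by rewrite /f insubT /=; apply/eqP; rewrite necklace_of_eq.
have [|W WE] := @tuple_seq_lift _ (sumn P) O.
  by apply/allP => o oO; rewrite (size_parikh (OP _ oO)).
have sW : size W == k by rewrite -sO -WE size_map.
exists (Tuple sW), t.
have cE : centres (Tuple sW) =i map (@necklace_of q (sumn P)) W.
  by move=> alpha; apply/imsetP/mapP => -[w wW ->]; exists w.
have cL : centres (Tuple sW) \subset L.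
  apply/subsetP => alpha; rewrite cE => /mapP [w wW ->].
  apply/imsetP; exists w => //.
  by rewrite inE; apply/forallP => i; rewrite OP // -WE map_f.
have cC : #|centres (Tuple sW)| = k.
  rewrite (eq_card cE) -(eqP sW) -(size_map (@necklace_of q (sumn P)) W).
  apply/card_uniqP; rewrite uniq_pairwise pairwise_map.
  move: Opw; rewrite -WE pairwise_map; apply: sub_pairwise => u v /=.
  by rewrite necklace_of_eq.
split => //; first by move: run; rewrite -WE -map_comp.
have Br := approx_rate_ge R q2 l0 k0; rewrite -/B in Br.
have r0 : (0 <= A * B * approx_rate R q (sumn P) k)%R.
  rewrite -mulrA mulr_ge0 ?(ltW A0) //; apply: le_trans Br; exact: ler0n.
(* If [k] is the size of the language, the output is the whole language and its value is at most
   0. *)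
move: kL; rewrite leq_eqVlt => /orP [/eqP kL|kL].
  have -> : centres (Tuple sW) = L by apply/eqP; rewrite eqEcard cL cC kL /=.
  apply: le_trans (centre_value_full R l0) _; apply: mule_ge0.
    by rewrite lee_fin.
  by apply: kcentre_optimum_ge0 => //; rewrite -/L -kL.
have [x [y [xy yx lx lxy]]] := two_most_frequent q2 P.
set p := tnth P y in lxy; set n := (trunc_log 2 (k * sumn P)).+1 in Br.
(* The successor in [(q * p).+1] keeps the [M] of [overlap_distance_le] positive when [p = 0]. *)
apply: (@le_trans _ _ (4 * (q * p).+1 * q ^ 2)%:R%:E).
  apply: centre_value_le => //; first by rewrite cC.
  move=> s v sL vL; apply: (@overlap_distance_le _ _ _ l0 _ _ x) => //.
  by apply: leq_trans lxy _; rewrite leq_add2l.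
apply: le_trans (lee_wpmul2l _ (kcentre_optimum_ge R l0 kL xy yx)); last first.
  by rewrite lee_fin.
rewrite -/p -/n -EFinM lee_fin.
apply: (@le_trans _ _ (A * n%:R * (p.+1%:R / (16 * n)%:R)))%R; last first.
  by rewrite ler_wpM2r ?divr_ge0 // -mulrA ler_pM2l.
have -> : (A * n%:R * (p.+1%:R / (16 * n)%:R) = (4 * q ^ 3 * p.+1)%:R)%R.
  by rewrite /A !natrM; field; rewrite pnatr_eq0.
rewrite ler_nat mulnAC [q ^ 3]expnS [q * q ^ 2]mulnC mulnA.
rewrite -[X in _ <= X]mulnA.
by rewrite leq_mul2l mulnS; apply/orP; right; lia.
Qed.
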